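(* Let $f:(0,+\infty)\to\mathbb{R}$ be a strictly monotonic and infinitely differentiable function, let $g:[0,1]\to\mathbb{R}$ be a symmetric distribution function, and let $\mathscr{I}_{f,g}$ be the $g$-weighted integral mean of the first kind with integrality function $f$, i.e. the mean given by $$\mathscr{I}_{f,g}(x,y)=f^{-1}\left(\int_0^1 f\left(tx+(1-t)y\right)g(t)\,dt\right)\quad(\forall x,y>0).$$ Then its characteristic function is $$Q_{\mathscr{I}_{f,g}}=c_1(g)\,\frac{f''}{f'},\qquad\text{where } c_1(g):=\int_0^1\left(t-\tfrac12\right)^2 g(t)\,dt.$$
   Context: A mean is a function $M:(0,+\infty)^2\to(0,+\infty)$ of class $C^\infty$ such that $\min(x,y)\le M(x,y)\le\max(x,y)$ and $M(x,y)=M(y,x)$ for all $x,y>0$. In particular, the mean $\mathscr{I}_{f,g}$ is by definition of class $C^\infty$. The characteristic function of a mean $M$ is $Q_M:(0,+\infty)\to\mathbb{R}$, $Q_M(x):=\frac{\partial^2 M}{\partial x^2}(x,x)$ (second partial derivative with respect to the first variable, evaluated at $(x,x)$). A function $g:[0,1]\to\mathbb{R}$ is a symmetric distribution function if: (i) $g\ge0$ almost everywhere on $[0,1]$; (ii) $g$ is Lebesgue-integrable on $[0,1]$ with $\int_0^1 g(t)\,dt=1$; (iii) $g(t)=g(1-t)$ for almost all $t\in[0,1]$. *)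

(* Defs.v *)
From HB Require Import structures.
From mathcomp Require Import all_boot all_order all_algebra.
From mathcomp Require Import all_classical all_reals all_analysis.

Set Implicit Arguments.
Unset Strict Implicit.
Unset Printing Implicit Defensive.
Import Order.TTheory GRing.Theory Num.Theory numFieldNormedType.Exports.
Local Open Scope ring_scope.
Local Open Scope classical_set_scope.

(* Lebesgue measure on the Lebesgue sigma-algebra: [lebesgue_measure] lives on
   the Borel sets, so it would require Borel-measurable integrands.            *)
Notation leb R := (@completed_lebesgue_measure R).

(* Functions on (0, +oo) and (0, +oo)^2 are total functions on R and R * R of
   which only the values at positive arguments are constrained.  As these
   domains are open, derivatives there do not depend on the outside values.    *)
Definition strictly_monotonic_pos (R : realType) (f : R -> R) : Prop :=
  (forall x y, 0 < x -> x < y -> f x < f y) \/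
  (forall x y, 0 < x -> x < y -> f y < f x).

Definition smooth_pos (R : realType) (f : R -> R) : Prop :=
  forall (n : nat) (x : R), 0 < x -> derivable f^`(n) x 1.

Definition basis2 (R : realType) (b : bool) : R * R :=
  if b then (0, 1) else (1, 0).

Definition partials (R : realType) (s : seq bool) (M : R * R -> R) :
    R * R -> R :=
  foldr (fun b h => 'D_(basis2 R b) h) M s.

Definition smooth_pos2 (R : realType) (M : R * R -> R) : Prop :=
  forall (s : seq bool) (p : R * R), 0 < p.1 -> 0 < p.2 ->
    (forall b, derivable (partials s M) p (basis2 R b)) /\
    {for p, continuous (partials s M)}.

Definition mean (R : realType) (M : R * R -> R) : Prop :=
  smooth_pos2 M /\
  forall x y, 0 < x -> 0 < y ->
    [/\ 0 < M (x, y), Num.min x y <= M (x, y) <= Num.max x y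
      & M (x, y) = M (y, x)].

Definition characteristic (R : realType) (M : R * R -> R) (x : R) : R :=
  'D_(1, 0) ('D_(1, 0) M) (x, x).

Definition symmetric_distribution (R : realType) (g : R -> R) : Prop :=
  [/\ {ae leb R, forall t : R, `[0, 1] t -> 0 <= g t},
      (leb R).-integrable `[0, 1] (EFin \o g),
      Rintegral (leb R) `[0, 1] g = 1
    & {ae leb R, forall t : R, `[0, 1] t -> g t = g (1 - t)}].

(* [pinv A f] is the inverse of f restricted to A. *)
Definition integral_mean (R : realType) (f g : R -> R) (p : R * R) : R :=
  pinv [set x : R | 0 < x] f
    (Rintegral (leb R) `[0, 1]
       (fun t : R => f (t * p.1 + (1 - t) * p.2) * g t)).

Definition c1 (R : realType) (g : R -> R) : R :=
  Rintegral (leb R) `[0, 1] (fun t : R => (t - 2^-1) ^+ 2 * g t).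

(* Main.v *)
Require Import Defs.
From HB Require Import structures.
From mathcomp Require Import all_boot all_order all_algebra ring lra.
From mathcomp Require Import all_classical all_reals all_analysis.
From mathcomp Require Import measurable_realfun.

(** Write E for averaging against g over the unit interval and M for the integral
    mean.  The mean solves f (M (x, y)) = E (f (t x + (1 - t) y)), by the
    intermediate value theorem ([integral_mean_average]).  Both sides are expanded
    to second order at (x + h, x).  The right-hand side inherits its expansion
    from that of f, because the remainder is uniform in t
    ([quadratic_expansion_average]); the left-hand side is handled by the chain
    rule, M being smooth.  Expansions are unique, so the coefficients agree.  With
    the symmetry of M this gives, at points where f' does not vanish, first-order
    partial derivative 1/2 and f' Q = c1 f'' ([characteristic_identity]).

    That f' never vanishes is a consequence of the smoothness of M.  Since c1 > 0
    ([c1_gt0]), the identity f' Q = c1 f'' and the continuity of Q bound |f''| by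
    a multiple of |f'| near any given point.  A zero of f' would then propagate to
    a whole interval ([gronwall_eq0]), on which f would be constant, contradicting
    strict monotonicity ([derive_neq0]). *)

Import Order.TTheory GRing.Theory Num.Theory numFieldNormedType.Exports.
Local Open Scope ring_scope.
Local Open Scope classical_set_scope.
Set Implicit Arguments.
Unset Strict Implicit.
Unset Printing Implicit Defensive.

(** * Second-order expansions and a Gronwall argument *)

(** The Taylor-Young condition phi h = a + b h + c h^2 + o(h^2) as h tends to 0,
    with the remainder estimate at h = 0 included, so that a = phi 0. *)
Definition quadratic_expansion {R : realType} (phi : R -> R) (a b c : R) :=
  forall e, 0 < e ->
    \forall h \near (0 : R), `|phi h - (a + b * h + c * h ^+ 2)| <= e * h ^+ 2.

(** The coefficients are recovered one degree at a time: evaluate at 0, divide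
    by h, then divide by h^2.  Allowing two functions that agree near 0 lets one
    compare expansions obtained from different expressions. *)
Lemma quadratic_expansion_unique {R : realType} (phi psi : R -> R)
    (a b c a' b' c' : R) :
  (\forall h \near (0 : R), phi h = psi h) ->
  quadratic_expansion phi a b c -> quadratic_expansion psi a' b' c' ->
  b = b' /\ c = c'.
Proof.
move=> eqphi Ephi Epsi.
have diff e : 0 < e -> exists2 d : R, 0 < d & forall h, `|h| < d ->
    `|(a - a') + (b - b') * h + (c - c') * h ^+ 2| <= e * h ^+ 2.
  move=> e0; have e20 : 0 < e / 2 by lra.
  have : \forall h \near (0 : R),
      `|(a - a') + (b - b') * h + (c - c') * h ^+ 2| <= e * h ^+ 2.
    near=> h.
    have h1 : `|phi h - (a + b * h + c * h ^+ 2)| <= e / 2 * h ^+ 2.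
      by near: h; exact: Ephi.
    have h2 : `|psi h - (a' + b' * h + c' * h ^+ 2)| <= e / 2 * h ^+ 2.
      by near: h; exact: Epsi.
    have h3 : phi h = psi h by near: h.
    move: h1 h2; rewrite h3 !ler_norml => /andP[? ?] /andP[? ?].
    by apply/andP; split; lra.
  case/nbhs_ballP => d /= d0 Hd; exists d => // h hd.
  by apply: Hd; rewrite /ball /= sub0r normrN.
have aa : a = a'.
  have [d d0 /(_ 0)] := diff 1 ltr01.
  rewrite normr0 => /(_ d0); rewrite !(mulr0, expr0n, addr0) normr_le0 subr_eq0.
  by move/eqP.
subst a'.
(* dividing by h leaves a first-order estimate for b - b' *)
have bb : b = b'.
  apply/eqP; rewrite -subr_eq0 -normr_le0; apply/ler_addgt0Pr => e e0.
  rewrite add0r; have [d d0 Hd] := diff 1 ltr01.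
  pose h := Num.min (d / 2) (e / (1 + `|c - c'|)).
  have K0 : 0 < 1 + `|c - c'| by rewrite ltr_pwDl.
  have h0 : 0 < h by rewrite lt_min divr_gt0//= divr_gt0.
  have hd : h < d by rewrite gt_min; apply/orP; left; lra.
  have he : h * (1 + `|c - c'|) <= e.
    by rewrite -ler_pdivlMr// ge_min lexx orbT.
  have := Hd h; rewrite gtr0_norm// => /(_ hd).
  rewrite subrr add0r mul1r expr2 !mulrA -mulrDl normrM (gtr0_norm h0).
  rewrite ler_pM2r// => H.
  have := ler_normD (b - b' + (c - c') * h) (- ((c - c') * h)).
  rewrite addrK normrN normrM (gtr0_norm h0); lra.
split=> //; subst b'.
apply/eqP; rewrite -subr_eq0 -normr_le0; apply/ler_addgt0Pr => e e0.
rewrite add0r; have [d d0 Hd] := diff e e0.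
have h0 : 0 < d / 2 by lra.
have hd : d / 2 < d by lra.
have := Hd (d / 2); rewrite (gtr0_norm h0) => /(_ hd).
rewrite !subrr mul0r !add0r normrM (@ger0_norm _ ((d / 2) ^+ 2)) ?sqr_ge0//.
by rewrite ler_pM2r// exprn_gt0.
Unshelve. all: by end_near. Qed.

Lemma derivable_linear_approx {R : realType} (v : R -> R) (x e : R) :
  derivable v x 1 -> 0 < e ->
  \forall h \near (0 : R), `|v (x + h) - (v x + 'D_1 v x * h)| <= e * `|h|.
Proof.
move=> /derivable_nbhsP/eqaddoP/= dv e0.
apply: filterS (dv e e0) => h /=.
by rewrite !fctE/= /shift/= /GRing.scale/= mulr1 (addrC x) (mulrC h).
Qed.

Lemma is_derive_quadratic {R : realType} (a b c s : R) :
  is_derive s (1 : R) (fun z : R => a + b * z + c * z ^+ 2) (b + 2 * c * s).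
Proof.
have is_id : is_derive s (1 : R) id (1 : R) := is_derive_id s 1.
have is_lin := is_deriveZ b is_id.
have is_sq := is_deriveZ c (is_deriveM is_id is_id).
have := is_deriveD (is_deriveD (is_derive_cst a s (1 : R)) is_lin) is_sq.
have -> : cst a + b *: id + c *: (id * id) =
    (fun z : R => a + b * z + c * z ^+ 2).
  by apply/funext => z; rewrite !fctE /GRing.scale/= expr2.
by move/is_derive_eq; apply; rewrite /GRing.scale/=; ring.
Qed.

(** The remainder has derivative u'(x + s) - u'(x) - u''(x) s, which is o(s)
    because u' is differentiable at x; the mean value theorem turns this into
    o(s^2). *)
Lemma taylor_young2 {R : realType} (u : R -> R) (x : R) :
  (\forall y \near x, derivable u y 1) -> derivable ('D_1 u) x 1 ->
  quadratic_expansion (fun h => u (x + h)) (u x) ('D_1 u x) ('D_1 ('D_1 u) x / 2).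
Proof.
move=> du ddu e e0.
have := derivable_linear_approx ddu e0.
move/(nbhs0P _ x).1 : du => du ap.
have [d /= d0 Hd] : nbhs_ball 0 (fun h : R => derivable u (x + h) 1 /\
    `|'D_1 u (x + h) - ('D_1 u x + 'D_1 ('D_1 u) x * h)| <= e * `|h|).
  by apply/nbhs_ballP; apply: filterI du ap.
apply/nbhs_ballP; exists d => //= h; rewrite /ball/= sub0r normrN => hd.
pose r (s : R) : R := u (x + s) - (u x + 'D_1 u x * s + 'D_1 ('D_1 u) x / 2 * s ^+ 2).
pose dr (s : R) : R := 'D_1 u (x + s) - ('D_1 u x + 'D_1 ('D_1 u) x * s).
have inball (s : R) : `|s| < d -> derivable u (x + s) 1 /\ `|dr s| <= e * `|s|.
  by move=> sd; apply: Hd; rewrite /ball/= sub0r normrN.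
have r_deriv (s : R) : `|s| < d -> is_derive s (1 : R) r (dr s).
  move=> /inball[dus _].
  have du_s : is_derive s (1 : R) (fun s => u (x + s)) ('D_1 u (x + s)).
    have := @is_derive1_comp _ u (fun s => x + s) s ('D_1 u (x + s)) 1.
    rewrite mulr1; apply.
      exact: derivableP.
    by rewrite (_ : (fun s => x + s) = shift x);
      [exact: is_derive_shift|apply/funext => z; rewrite /= addrC].
  have q_s := is_derive_quadratic (u x) ('D_1 u x) ('D_1 ('D_1 u) x / 2) s.
  by apply: (is_derive_eq (is_deriveB du_s q_s)); rewrite /dr; field.
have r0 : r 0 = 0 by rewrite /r addr0 mulr0 expr0n/= mulr0 !addr0 subrr.
rewrite -/(r h).
have r_cont a b : `|a| < d -> `|b| < d -> {within `[a, b], continuous r}.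
  move=> ad bd; apply: derivable_within_continuous => z zab.
  apply: (@ex_derive _ _ _ _ _ _ (dr z)); apply: r_deriv.
  by move: zab ad bd; rewrite in_itv/= !ltr_norml; lra.
have [c ch rE] : exists2 c, `|c| <= `|h| & r h = dr c * h.
  have [h0|h0] := leP 0 h.
    have [||c] := @MVT_segment R r dr 0 h h0.
    - move=> z; rewrite in_itv/= => zh; apply: r_deriv.
      by move: hd; rewrite !ltr_norml; lra.
    - by apply: r_cont => //; rewrite normr0.
    rewrite in_itv/= r0 !subr0 => /andP[c0 ch] ->; exists c => //.
    by rewrite !ger0_norm.
  have [||c] := @MVT_segment R r dr h 0 (ltW h0).
  - move=> z; rewrite in_itv/= => zh; apply: r_deriv.
    by move: hd; rewrite !ltr_norml; lra.
  - by apply: r_cont => //; rewrite normr0.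
  rewrite in_itv/= r0 !sub0r mulrN => /andP[hc c0] /oppr_inj ->; exists c => //.
  by rewrite !ler0_norm ?lerN2// ltW.
rewrite rE normrM -real_normK ?num_real// expr2 mulrA ler_wpM2r//.
have [_ /le_trans->//] := inball c (le_lt_trans ch hd).
by rewrite ler_wpM2l// ltW.
Qed.

(** Under |u'| <= L |u| the function u^2 exp(- 2 L z) is nonincreasing, so it
    stays at 0 once it is 0.  The bound is asked only where u does not vanish,
    since at a zero of u the derivative of u^2 is 0 anyway. *)
Lemma gronwall_eq0 {R : realType} (u du : R -> R) (a b L : R) :
  (forall y, y \in `[a, b]%R -> is_derive y (1 : R) u (du y)) ->
  (forall y, y \in `[a, b]%R -> u y != 0 -> `|du y| <= L * `|u y|) ->
  u a = 0 -> forall y, y \in `[a, b]%R -> u y = 0.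
Proof.
move=> u_deriv du_le ua y yab.
pose v (z : R) : R := u z ^+ 2 * expR (- (2 * L * z)).
pose dv (z : R) : R := (2 * u z * du z - 2 * L * u z ^+ 2) * expR (- (2 * L * z)).
have v_deriv z : z \in `[a, b]%R -> is_derive z (1 : R) v (dv z).
  move=> /u_deriv uz.
  have ez : is_derive z (1 : R) (fun z : R => expR (- (2 * L * z)))
      (expR (- (2 * L * z)) * - (2 * L)).
    apply: (@is_derive1_comp _ expR (fun z => - (2 * L * z))).
    have -> : (fun z : R => - (2 * L * z)) = - (cst (2 * L) * id) by [].
    by apply: is_derive_eq; rewrite /= /GRing.scale/=; ring.
  have -> : v = u ^+ 2 * (fun z : R => expR (- (2 * L * z))).
    by apply/funext => t; rewrite /v !fctE.
  apply: is_derive_eq; rewrite !fctE /dv /GRing.scale/=.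
  by move: (expR _) (u z) (du z) => e uz' duz; ring.
have dv_le z : z \in `[a, b]%R -> dv z <= 0.
  move=> zab; rewrite /dv mulr_le0_ge0 ?expR_ge0//.
  have [->|uz] := eqVneq (u z) 0; first by rewrite expr0n/= !mulr0 mul0r subrr.
  have duz := du_le z zab uz.
  have : u z * du z <= `|u z| * (L * `|u z|).
    by rewrite (le_trans (ler_norm _))// normrM ler_wpM2l.
  rewrite -(real_normK (num_real (u z))) expr2; lra.
have [ay yb] : a <= y /\ y <= b by move: yab; rewrite in_itv/= => /andP.
have : v y <= v a.
  apply: (@ler0_derive1_nincr R v a b) => //.
  - by move=> z /subset_itv_oo_cc/v_deriv[].
  - move=> z /subset_itv_oo_cc zab.
    by have vz := v_deriv z zab; rewrite derive1E derive_val dv_le.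
  - by apply: derivable_within_continuous => z /v_deriv[].
rewrite {2}/v ua expr0n/= mul0r /v pmulr_lle0 ?expR_gt0// => uy.
by apply/eqP; rewrite -sqrf_eq0 eq_le uy sqr_ge0.
Qed.

(** * Integrals against an almost everywhere nonnegative weight *)

Lemma integrable_weighted d (T : measurableType d) (R : realType)
    (mu : {measure set T -> \bar R}) (D : set T) (g h : T -> R) :
  measurable D -> mu.-integrable D (EFin \o g) ->
  measurable_fun D h -> [bounded h x | x in D] ->
  mu.-integrable D (EFin \o (fun t => h t * g t)).
Proof. by move=> mD ig mh bh; apply: (integrableMr _ _ _ ig). Qed.

(** The weight is nonnegative only almost everywhere, whereas monotonicity of
    the integral is stated pointwise; the positive part is an everywhere
    nonnegative substitute for the weight. *)
Lemma Rintegral_weighted_pos_part d (T : measurableType d) (R : realType)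
    (mu : {measure set T -> \bar R}) (D : set T) (g h : T -> R) :
  measurable D -> mu.-integrable D (EFin \o g) ->
  {ae mu, forall t, D t -> 0 <= g t} ->
  measurable_fun D h -> [bounded h x | x in D] ->
  mu.-integrable D (EFin \o (fun t => h t * Num.max (g t) 0)) /\
  (\int[mu]_(t in D) (h t * g t) = \int[mu]_(t in D) (h t * Num.max (g t) 0))%R.
Proof.
move=> mD ig g0 mh bh.
have iG : mu.-integrable D (EFin \o (fun t => Num.max (g t) 0)).
  have := integrable_funepos mD ig.
  by apply: eq_integrable => // t _; rewrite /= funeposE/= EFin_max.
have ihG := integrable_weighted mD iG mh bh.
split=> //; congr fine; apply: ae_eq_integral => //.
- exact: measurable_int (integrable_weighted mD ig mh bh).
- exact: measurable_int ihG.
case: g0 => N [mN N0 gN]; exists N; split => // t /= nt; apply: gN => /= gt.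
by apply: nt => tI; rewrite max_l// gt.
Qed.

Lemma Rintegral_weighted_ge0 d (T : measurableType d) (R : realType)
    (mu : {measure set T -> \bar R}) (D : set T) (g h : T -> R) :
  measurable D -> mu.-integrable D (EFin \o g) ->
  {ae mu, forall t, D t -> 0 <= g t} ->
  measurable_fun D h -> [bounded h x | x in D] ->
  (forall t, D t -> 0 <= h t) -> 0 <= (\int[mu]_(t in D) (h t * g t))%R.
Proof.
move=> mD ig g0 mh bh h0.
have [_ ->] := Rintegral_weighted_pos_part mD ig g0 mh bh.
by apply: Rintegral_ge0 => t Dt; rewrite mulr_ge0 ?h0// le_max lexx orbT.
Qed.

(** A nonnegative integrand of zero integral vanishes almost everywhere, hence
    so does its factor g wherever h is nonzero. *)
Lemma Rintegral_weighted_eq0 d (T : measurableType d) (R : realType)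
    (mu : {measure set T -> \bar R}) (D : set T) (g h : T -> R) :
  measurable D -> mu.-integrable D (EFin \o g) ->
  {ae mu, forall t, D t -> 0 <= g t} ->
  measurable_fun D h -> [bounded h x | x in D] ->
  (forall t, D t -> 0 <= h t) ->
  {ae mu, forall t, D t -> h t != 0} ->
  (\int[mu]_(t in D) (h t * g t) = 0)%R -> (\int[mu]_(t in D) g t = 0)%R.
Proof.
move=> mD ig g0 mh bh h0 hne0.
have [ihG ->] := Rintegral_weighted_pos_part mD ig g0 mh bh.
move=> hG0; have mhG := measurable_int _ ihG.
have /(ae_eq_integral_abs _ mD mhG) hGae :
    (\int[mu]_(t in D) `|(h t * Num.max (g t) 0)%R%:E| = 0)%E.
  transitivity (\int[mu]_(t in D) (h t * Num.max (g t) 0)%R%:E)%E.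
    apply: eq_integral => t /set_mem Dt /=; rewrite ger0_norm//.
    by rewrite mulr_ge0 ?h0// le_max lexx orbT.
  move: hG0; rewrite /Rintegral => hG0.
  rewrite -[LHS]fineK; first by rewrite hG0.
  exact: (integrable_fin_num mD ihG).
transitivity (\int[mu]_(t in D) (cst 0 : T -> R) t)%R; last first.
  by rewrite Rintegral_cst// mul0r.
congr fine; apply: ae_eq_integral => //; first exact: measurable_int ig.
- by apply/measurable_EFinP; exact: measurable_cst.
apply: (filterS3 _ _ hGae g0 hne0) => t + + + Dt.
move=> /(_ Dt) + /(_ Dt) gt /(_ Dt) ht; rewrite /= max_l// => -[] /eqP.
by rewrite mulf_eq0 (negbTE ht) => /eqP ->.
Qed.

(** * Averages over the unit interval *)

(** Linear, positive and normalised in h when g is a symmetric distribution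
    function. *)
Definition average {R : realType} (g h : R -> R) : R :=
  Rintegral (leb R) `[0, 1] (fun t : R => h t * g t).

(** The sigma-algebra completed for Lebesgue measure is Caratheodory's; Borel
    sets have to be transported to it explicitly. *)
Lemma measurable_borel_leb {R : realType} (A : set R) :
  measurable A -> (wlength (R := R) idfun)^*%mu.-cara.-measurable A.
Proof. by move=> mA; apply: sub_caratheodory. Qed.

Lemma measurable_unit_leb (R : realType) :
  (wlength (R := R) idfun)^*%mu.-cara.-measurable `[0, 1]%classic.
Proof. by apply: measurable_borel_leb; exact: measurable_itv. Qed.

Lemma continuous_unit_leb {R : realType} (h : R -> R) :
  {within `[0, 1], continuous h} ->
  measurable_fun (`[0, 1] : set (caratheodory_type (wlength (R := R) idfun)^*%mu)) h
  /\ [bounded h x | x in (`[0, 1] : set R)].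
Proof.
move=> ch; split.
  move=> _ Y mY; apply: measurable_borel_leb.
  exact: (subspace_continuous_measurable_fun (measurable_itv _) ch).
have : compact (h @` `[0, 1]).
  apply: continuous_compact => //; exact: segment_compact.
move=> /compact_bounded[M [Mreal HM]]; exists M; split => // r Mr t tI.
by apply: HM => //; exists t.
Qed.

Lemma average_integrable {R : realType} (g h : R -> R) :
  symmetric_distribution g -> {within `[0, 1], continuous h} ->
  (leb R).-integrable `[0, 1] (EFin \o (fun t : R => h t * g t)).
Proof.
move=> [_ ig _ _] /continuous_unit_leb[mh bh].
apply: (integrable_weighted _ ig) => //; exact: measurable_unit_leb.
Qed.

Lemma averageD {R : realType} (g h k : R -> R) :
  symmetric_distribution g -> {within `[0, 1], continuous h} ->
  {within `[0, 1], continuous k} ->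
  average g (fun t => h t + k t) = average g h + average g k.
Proof.
move=> gd ch ck; rewrite -RintegralD.
- by apply: eq_Rintegral => t _; rewrite mulrDl.
- exact: measurable_unit_leb.
- exact: average_integrable.
- exact: average_integrable.
Qed.

Lemma averageZ {R : realType} (g h : R -> R) (r : R) :
  symmetric_distribution g -> {within `[0, 1], continuous h} ->
  average g (fun t => r * h t) = r * average g h.
Proof.
move=> gd ch; rewrite -RintegralZl.
- by apply: eq_Rintegral => t _; rewrite mulrA.
- exact: measurable_unit_leb.
- exact: average_integrable.
Qed.

Lemma average_cst {R : realType} (g : R -> R) (r : R) :
  symmetric_distribution g -> average g (fun=> r) = r.
Proof.
move=> [_ ig g1 _]; rewrite /average RintegralZl//.
- by rewrite g1 mulr1.
- exact: measurable_unit_leb.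
Qed.

Lemma average_le {R : realType} (g h k : R -> R) :
  symmetric_distribution g -> {within `[0, 1], continuous h} ->
  {within `[0, 1], continuous k} -> (forall t : R, 0 <= t <= 1 -> h t <= k t) ->
  average g h <= average g k.
Proof.
move=> gd ch ck hk; rewrite -subr_ge0 -[X in _ - X]mul1r -mulNr -averageZ//.
have cN : {within `[0, 1], continuous (fun t : R => -1 * h t)}.
  by move=> t; apply: cvgMr; exact: ch.
have cB : {within `[0, 1], continuous (fun t : R => k t + -1 * h t)}.
  by move=> t; apply: cvgD; [exact: ck | exact: cN].
rewrite -averageD//.
have [mB bB] := continuous_unit_leb cB; case: gd => g0 ig _ _.
apply: (Rintegral_weighted_ge0 _ ig g0 mB bB) => [|t /=].
  exact: measurable_unit_leb.
by rewrite in_itv/= mulN1r subr_ge0 => /hk.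
Qed.

Lemma leb_set1 {R : realType} (a : R) : leb R [set a] = 0%E.
Proof. exact: (lebesgue_measure_set1 a). Qed.

(** If the integral of (t - 1/2)^2 g vanished, then g would vanish almost
    everywhere off the null set {1/2}, and could not have total mass 1. *)
Lemma c1_gt0 {R : realType} (g : R -> R) :
  symmetric_distribution g -> 0 < c1 g.
Proof.
move=> gd; pose h (t : R) := (t - 2^-1) ^+ 2.
have ch : {within `[0, 1], continuous h}.
  apply: continuous_subspaceT => t.
  have ct : {for t, continuous (fun t : R => t - 2^-1)}.
    by apply: cvgB; [exact: cvg_id|exact: cvg_cst].
  by apply: (cvgM ct ct).
rewrite lt_neqAle; apply/andP; split; last first.
  rewrite -[X in X <= _](average_cst _ gd).
  apply: average_le => //; first by apply: continuous_subspaceT => t; exact: cvg_cst.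
  by move=> t _; exact: sqr_ge0.
apply/eqP => /esym c0; case: gd => g0 ig g1 _.
have [mh bh] := continuous_unit_leb ch.
suff : Rintegral (leb R) `[0, 1] g = 0.
  by rewrite g1 => /eqP; rewrite oner_eq0.
apply: (Rintegral_weighted_eq0 _ ig g0 mh bh _ _ c0).
- exact: measurable_unit_leb.
- by move=> t _; exact: sqr_ge0.
- exists [set 2^-1]; split.
  + by apply: measurable_borel_leb; exact: measurable_set1.
  + exact: leb_set1.
  + move=> t /=; apply: contra_notP => /eqP t2 _.
    by rewrite sqrf_eq0 subr_eq0.
Qed.

Lemma average_onem {R : realType} (g : R -> R) :
  symmetric_distribution g ->
  average g (fun t => 1 - t) = 1 - average g id.
Proof.
move=> gd; have cid : {within `[0, 1], continuous (fun t : R => t)}.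
  by apply: continuous_subspaceT => t; exact: cvg_id.
have cst_cont (k : R) : {within `[0, 1], continuous (fun _ : R => k)}.
  by move=> t; exact: cvg_cst.
have -> : average g (fun t => 1 - t) = average g (fun t => 1 + (- 1) * t).
  by congr average; apply/funext => t; rewrite mulN1r.
rewrite averageD//; last by move=> t; apply: cvgMr; exact: cid.
by rewrite averageZ// average_cst// mulN1r.
Qed.

Lemma c1_moments {R : realType} (g : R -> R) :
  symmetric_distribution g ->
  c1 g = average g (fun t => t ^+ 2) - average g id + 4^-1.
Proof.
move=> gd; have cid : {within `[0, 1], continuous (fun t : R => t)}.
  by apply: continuous_subspaceT => t; exact: cvg_id.
have cst_cont (k : R) : {within `[0, 1], continuous (fun _ : R => k)}.
  by move=> t; exact: cvg_cst.
have csq : {within `[0, 1], continuous (fun t : R => t ^+ 2)}.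
  by apply: continuous_subspaceT => t; exact: exprn_continuous.
have cN : {within `[0, 1], continuous (fun t : R => -1 * t)}.
  by move=> t; apply: cvgMr; exact: cid.
have -> : c1 g = average g (fun t => t ^+ 2 + -1 * t + 4^-1).
  by apply: eq_Rintegral => t _; congr (_ * _); field.
rewrite averageD//; last by move=> t; apply: cvgD; [exact: csq|exact: cN].
by rewrite averageD// averageZ// average_cst// mulN1r.
Qed.

(** * Expansion of averages *)

(** As |w t * h| <= |h|, the error of the expansion of phi at w t * h is at
    most e h^2 uniformly in t, so it survives averaging against g.  This replaces
    differentiation under the integral sign. *)
Lemma quadratic_expansion_average {R : realType} (g w phi : R -> R) (a b c : R) :
  symmetric_distribution g -> {within `[0, 1], continuous w} ->
  (forall t : R, 0 <= t <= 1 -> `|w t| <= 1) ->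
  (\forall h \near (0 : R),
    {within `[0, 1], continuous (fun t : R => phi (w t * h))}) ->
  quadratic_expansion phi a b c ->
  quadratic_expansion (fun h => average g (fun t => phi (w t * h)))
    a (b * average g w) (c * average g (fun t => w t ^+ 2)).
Proof.
move=> gd cw w1 cphi Ephi e e0.
have [d /= d0 Hd] := (nbhs_ballP _ _).1 (filterI cphi (Ephi e e0)).
apply/nbhs_ballP; exists d => //= h hd.
have ch := (Hd h hd).1.
have small t : 0 <= t <= 1 -> `|phi (w t * h) -
    (a + b * (w t * h) + c * (w t * h) ^+ 2)| <= e * h ^+ 2.
  move=> t01; have wh : `|w t * h| <= `|h|.
    by rewrite normrM ler_piMl// w1.
  have [|_ /le_trans->//] := Hd (w t * h).
    by move: hd; rewrite /ball/= !sub0r !normrN; exact: le_lt_trans.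
  apply: ler_wpM2l; first exact: ltW.
  rewrite -(real_normK (num_real (w t * h))).
  by rewrite -(real_normK (num_real h)) lerXn2r ?nnegrE.
have c2 : {within `[0, 1], continuous (fun t : R => w t ^+ 2)}.
  by move=> t; apply: (cvgM (cw t) (cw t)).
pose p (k t : R) := (k + (b * h) * w t) + (c * h ^+ 2) * w t ^+ 2.
have ck (k : R) : {within `[0, 1], continuous (fun _ : R => k)}.
  by move=> t; exact: cvg_cst.
have cZ (k : R) (v : R -> R) : {within `[0, 1], continuous v} ->
    {within `[0, 1], continuous (fun t : R => k * v t)}.
  by move=> cv t; apply: cvgMr; exact: cv.
have cD (u v : R -> R) : {within `[0, 1], continuous u} ->
    {within `[0, 1], continuous v} ->
    {within `[0, 1], continuous (fun t : R => u t + v t)}.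
  by move=> cu cv t; apply: cvgD; [exact: cu|exact: cv].
have cp (k : R) : {within `[0, 1], continuous (p k)}.
  by apply: (cD _ _ (cD _ _ _ _)); [exact: ck|exact: cZ|exact: cZ].
have avgp (k : R) : average g (p k) = k + b * h * average g w +
    c * h ^+ 2 * average g (fun t => w t ^+ 2).
  rewrite averageD//; [|by apply: cD => //; exact: cZ|exact: cZ].
  by rewrite averageD ?averageZ ?average_cst//; exact: cZ.
have up : average g (fun t => phi (w t * h)) <= average g (p (a + e * h ^+ 2)).
  apply: average_le => // t /small; rewrite /p ler_norml exprMn => /andP[_]; lra.
have lo : average g (p (a - e * h ^+ 2)) <= average g (fun t => phi (w t * h)).
  apply: average_le => // t /small; rewrite /p ler_norml exprMn => /andP[+ _]; lra.
move: up lo; rewrite !avgp ler_norml => ? ?; apply/andP; split; lra.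
Qed.

(** * The implicit equation of the integral mean *)

Lemma segment_pos {R : realType} (x y t : R) :
  0 < x -> 0 < y -> 0 <= t <= 1 ->
  [/\ 0 < t * x + (1 - t) * y, Num.min x y <= t * x + (1 - t) * y
    & t * x + (1 - t) * y <= Num.max x y].
Proof.
move=> x0 y0 /andP[t0 t1].
have tc : 0 <= 1 - t by lra.
have b z : z <= x -> z <= y -> z <= t * x + (1 - t) * y.
  by move=> zx zy; have := ler_wpM2l t0 zx; have := ler_wpM2l tc zy; lra.
have mn : Num.min x y <= t * x + (1 - t) * y.
  by apply: b; rewrite ge_min lexx ?orbT.
split=> //; first by apply: lt_le_trans mn; rewrite lt_min x0.
have xM : x <= Num.max x y by rewrite le_max lexx.
have yM : y <= Num.max x y by rewrite le_max lexx orbT.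
by have := ler_wpM2l t0 xM; have := ler_wpM2l tc yM; lra.
Qed.

Lemma continuous_comp_unit {R : realType} (f w : R -> R) :
  continuous w -> (forall t : R, 0 <= t <= 1 -> {for w t, continuous f}) ->
  {within `[0, 1], continuous (fun t : R => f (w t))}.
Proof.
move=> cw cf; apply: continuous_in_subspaceT => t /set_mem /=.
rewrite in_itv/= => /cf; apply: continuous_comp; exact: cw.
Qed.

Lemma smooth_pos_continuous {R : realType} (f : R -> R) (x : R) :
  smooth_pos f -> 0 < x -> {for x, continuous f}.
Proof.
move=> f_smooth x0; apply: differentiable_continuous.
by apply/derivable1_diffP; exact: (f_smooth 0%N x x0).
Qed.

(** The mean is defined through a total inverse of f, which is a genuine
    inverse only on the image of f.  The average of f along the segment from y
    to x lies between the values of f at the endpoints, so the intermediate value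
    theorem puts it in that image. *)
Lemma integral_mean_average {R : realType} (f g : R -> R) (x y : R) :
  strictly_monotonic_pos f -> smooth_pos f -> symmetric_distribution g ->
  0 < x -> 0 < y ->
  f (integral_mean f g (x, y)) = average g (fun t => f (t * x + (1 - t) * y)).
Proof.
move=> f_mono f_smooth gd x0 y0.
set a := Num.min x y; set b := Num.max x y.
have a0 : 0 < a by rewrite lt_min x0.
have ab : a <= b by rewrite ge_min le_max lexx.
have cst_cont (k : R) : {within `[0, 1], continuous (fun _ : R => k)}.
  by move=> t; exact: cvg_cst.
have cf : {within `[0, 1], continuous (fun t : R => f (t * x + (1 - t) * y))}.
  apply: (@continuous_comp_unit _ f (fun t => t * x + (1 - t) * y)).
    move=> t; apply: cvgD; first by apply: cvgMl; exact: cvg_id.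
    by apply: cvgMl; apply: cvgB; [exact: cvg_cst|exact: cvg_id].
  by move=> t /(segment_pos x0 y0)[? _ _]; exact: smooth_pos_continuous.
have f_btw z : a <= z -> z <= b -> Num.min (f a) (f b) <= f z <= Num.max (f a) (f b).
  rewrite le_eqVlt => /predU1P[<- _|az]; first by rewrite ge_min le_max lexx.
  rewrite le_eqVlt => /predU1P[->|zb]; first by rewrite ge_min le_max lexx !orbT.
  have z0 := lt_trans a0 az.
  rewrite ge_min le_max; case: f_mono => f_mono.
    by rewrite (ltW (f_mono a z a0 az)) (ltW (f_mono z b z0 zb)) orbT.
  by rewrite (ltW (f_mono a z a0 az)) (ltW (f_mono z b z0 zb)) orbT.
have avg_btw : Num.min (f a) (f b) <=
    average g (fun t => f (t * x + (1 - t) * y)) <= Num.max (f a) (f b).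
  apply/andP; split.
    rewrite -[X in X <= _](average_cst _ gd); apply: average_le => // t.
    by move=> /(segment_pos x0 y0)[_ at_ tb]; have /andP[] := f_btw _ at_ tb.
  rewrite -[X in _ <= X](average_cst _ gd); apply: average_le => // t.
  by move=> /(segment_pos x0 y0)[_ at_ tb]; have /andP[] := f_btw _ at_ tb.
have [|c cab fc] := IVT ab _ avg_btw.
  apply: derivable_within_continuous => z; rewrite in_itv/= => /andP[az _].
  exact: (f_smooth 0%N z (lt_le_trans a0 az)).
apply: pinvK; apply/mem_set; exists c => //=.
by move: cab; rewrite in_itv/= => /andP[/(lt_le_trans a0)].
Qed.

(** * Characteristic function of the integral mean *)

Lemma slice_is_derive {R : realType} (h : R * R -> R) (x y : R) :
  derivable h (y, x) (1, 0) ->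
  is_derive y (1 : R) (fun z : R => h (z, x)) ('D_(1, 0) h (y, x)).
Proof.
move=> dh.
have E : (fun k : R => k^-1 *: (((fun z : R => h (z, x)) \o shift y) (k *: 1) - h (y, x)))
   = (fun k : R => k^-1 *: ((h \o shift (y, x)) (k *: (1, 0)) - h (y, x))).
  apply/funext => k /=; congr (_ *: (h _ - _)).
  by rewrite /shift/=; congr pair; rewrite /= ?scaler0 ?add0r.
by apply: DeriveDef; rewrite /derivable /derive E.
Qed.

(** The weights w t = t and w t = 1 - t correspond to moving the first and the
    second argument of the mean away from the diagonal. *)
Lemma average_expansion {R : realType} (f g w : R -> R) (x : R) :
  smooth_pos f -> symmetric_distribution g -> 0 < x -> continuous w ->
  (forall t : R, 0 <= t <= 1 -> `|w t| <= 1) ->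
  quadratic_expansion (fun h => average g (fun t => f (x + w t * h)))
    (f x) ('D_1 f x * average g w)
    ('D_1 ('D_1 f) x / 2 * average g (fun t => w t ^+ 2)).
Proof.
move=> f_smooth gd x0 cw w1.
apply: (@quadratic_expansion_average _ g w (fun h => f (x + h))) => //.
- exact: continuous_subspaceT.
- apply/nbhs_ballP; exists x => //= h; rewrite /ball/= sub0r normrN => hx.
  apply: (@continuous_comp_unit _ f (fun t => x + w t * h)).
    by move=> t; apply: cvgD; [exact: cvg_cst|apply: cvgMl; exact: cw].
  move=> t /w1 wt; apply: smooth_pos_continuous => //.
  have : `|w t * h| < x by rewrite normrM (le_lt_trans _ hx)// ler_piMl.
  by rewrite ltr_norml; lra.
- apply: taylor_young2.
    by apply: filterS (lt_nbhsr x0) => y; exact: (f_smooth 0%N).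
  have <- : f^`() = 'D_1 f by apply/funext => y; rewrite derive1E.
  exact: (f_smooth 1%N).
Qed.

(** Put m(y) = M(y,x).  The function f o m has two expansions at x: one from the
    chain rule, with coefficients f' m' and (f'' m'^2 + f' m'')/2, one from
    averaging f, with coefficients f' E(t) and f'' E(t^2)/2.  By symmetry of M it
    also has the expansion obtained from M(x, x + h), with f' E(1 - t) at first
    order.  When f'(x) is nonzero these give m' = E(t) = 1/2, and the
    second-order coefficients then give f' m'' = (E(t^2) - 1/4) f'' = c1 f''. *)
Lemma characteristic_identity {R : realType} (f g : R -> R) (x : R) :
  strictly_monotonic_pos f -> smooth_pos f -> symmetric_distribution g ->
  mean (integral_mean f g) -> 0 < x -> 'D_1 f x != 0 ->
  'D_1 f x * characteristic (integral_mean f g) x = c1 g * 'D_1 ('D_1 f) x.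
Proof.
move=> f_mono f_smooth gd [M_smooth M_mean] x0 f'x.
set M := integral_mean f g in M_smooth M_mean *.
have f'E : f^`() = 'D_1 f by apply/funext => y; rewrite derive1E.
have fM (y z : R) : 0 < y -> 0 < z ->
    f (M (y, z)) = average g (fun t => f (t * y + (1 - t) * z)).
  by move=> *; exact: integral_mean_average.
have Mxx : M (x, x) = x.
  have [_ + _] := M_mean x x x0 x0; rewrite minxx maxxx => /andP[? ?].
  by apply/eqP; rewrite eq_le; apply/andP.
have df (y : R) : 0 < y -> derivable f y 1 by exact: (f_smooth 0%N).
have ddf (y : R) : 0 < y -> derivable ('D_1 f) y 1.
  by rewrite -f'E; exact: (f_smooth 1%N).
pose m (y : R) := M (y, x).
pose psi (y : R) := f (m y).
pose dm (y : R) : R := 'D_(1, 0) M (y, x).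
have m_deriv (y : R) : 0 < y -> is_derive y (1 : R) m (dm y).
  by move=> y0; apply: slice_is_derive; exact: (M_smooth [::] (y, x) y0 x0).1 false.
have dm_deriv : is_derive x (1 : R) dm (characteristic M x).
  by apply: slice_is_derive; exact: (M_smooth [:: false] (x, x) x0 x0).1 false.
have psi_deriv (y : R) : 0 < y -> is_derive y (1 : R) psi ('D_1 f (m y) * dm y).
  move=> y0; have [m0 _ _] := M_mean y x y0 x0.
  apply: (@is_derive1_comp _ f m); last exact: m_deriv.
  by apply: derivableP; exact: df.
have pos_near : \forall y \near x, 0 < y by exact: lt_nbhsr.
have dpsiE : \forall y \near x, (('D_1 f \o m) * dm) y = 'D_1 psi y.
  by apply: filterS pos_near => y /psi_deriv py; rewrite derive_val.
have dpsi_deriv : is_derive x (1 : R) ('D_1 psi)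
    ('D_1 ('D_1 f) x * dm x * dm x + 'D_1 f x * characteristic M x).
  have f'm_deriv : is_derive x (1 : R) ('D_1 f \o m) ('D_1 ('D_1 f) x * dm x).
    apply: is_derive1_comp; last exact: m_deriv.
    by rewrite /m Mxx; apply: derivableP; exact: ddf.
  apply: near_eq_is_derive dpsiE _.
  apply: is_derive_eq; rewrite /GRing.scale/= /m Mxx; ring.
have psi0 : psi x = f x by rewrite /psi /m Mxx.
have psi1 : 'D_1 psi x = 'D_1 f x * dm x.
  by have px := psi_deriv x x0; rewrite derive_val /m Mxx.
have Epsi : quadratic_expansion (fun h => psi (x + h)) (f x) ('D_1 f x * dm x)
    (('D_1 ('D_1 f) x * dm x * dm x + 'D_1 f x * characteristic M x) / 2).
  rewrite -psi0 -psi1 -(derive_val (is_derive := dpsi_deriv)).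
  apply: taylor_young2; last by case: dpsi_deriv.
  by apply: filterS pos_near => y /psi_deriv[].
have id_cont : continuous (fun t : R => t) by move=> t; exact: cvg_id.
have onem_cont : continuous (fun t : R => 1 - t).
  by move=> t; apply: cvgB; [exact: cvg_cst|exact: cvg_id].
have id_le1 (t : R) : 0 <= t <= 1 -> `|t| <= 1 by rewrite ler_norml; lra.
have onem_le1 (t : R) : 0 <= t <= 1 -> `|1 - t| <= 1 by rewrite ler_norml; lra.
have Eid := average_expansion f_smooth gd x0 id_cont id_le1.
have Eonem := average_expansion f_smooth gd x0 onem_cont onem_le1.
have pos_near0 : \forall h \near (0 : R), 0 < x + h by move: pos_near => /nbhs0P.
have psi_id : \forall h \near (0 : R),
    psi (x + h) = average g (fun t => f (x + t * h)).
  apply: filterS pos_near0 => h xh; rewrite /psi /m fM//.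
  by congr (average g _); apply/funext => t; congr f; ring.
have psi_onem : \forall h \near (0 : R),
    psi (x + h) = average g (fun t => f (x + (1 - t) * h)).
  apply: filterS pos_near0 => h xh; rewrite /psi /m.
  have [_ _ ->] := M_mean (x + h) x xh x0; rewrite fM//.
  by congr (average g _); apply/funext => t; congr f; ring.
have [b_id c_id] := quadratic_expansion_unique psi_id Epsi Eid.
have [b_onem _] := quadratic_expansion_unique psi_onem Epsi Eonem.
have dm_avg := mulfI f'x b_id.
have avg_half : average g id = 2^-1.
  by have := mulfI f'x b_onem; rewrite dm_avg average_onem//; lra.
have c1E : c1 g = average g (fun t => t ^+ 2) - 4^-1.
  by rewrite c1_moments// avg_half; field.
move: c_id; rewrite dm_avg avg_half c1E; lra.
Qed.

Lemma continuous_near_le {R : realType} (h : R -> R) (x : R) :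
  {for x, continuous h} -> \forall y \near x, `|h y| <= `|h x| + 1.
Proof.
move/cvgrPdist_le/(_ 1 ltr01); apply: filterS => y hxy.
by have := ler_normB (h x) (h x - h y); rewrite subKr; lra.
Qed.

(** Suppose f'(x) = 0.  The characteristic function Q is continuous, hence
    bounded near x, and c1 > 0, so wherever f' does not vanish the identity
    f' Q = c1 f'' bounds |f''| by a multiple of |f'|.  By Gronwall f' vanishes on
    an interval to the right of x, so f is constant there, against strict
    monotonicity. *)
Lemma derive_neq0 {R : realType} (f g : R -> R) (x : R) :
  strictly_monotonic_pos f -> smooth_pos f -> symmetric_distribution g ->
  mean (integral_mean f g) -> 0 < x -> 'D_1 f x != 0.
Proof.
move=> f_mono f_smooth gd M_mean x0; apply/eqP => f'x.
have f'E : f^`() = 'D_1 f by apply/funext => y; rewrite derive1E.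
have [Q QE] : exists Q, Q = characteristic (integral_mean f g) by eexists.
have Q_cont : {for x, continuous Q}.
  rewrite QE.
  have MC : {for (x, x), continuous (partials [:: false; false] (integral_mean f g))}.
    exact: (M_mean.1 [:: false; false] (x, x) x0 x0).2.
  have dC : {for x, continuous (fun y : R => (y, y))}.
    exact: (@cvg_pair R R R (nbhs x) (nbhs x) (nbhs x) _ _ _ id id
      (@cvg_id _ _) (@cvg_id _ _)).
  exact: (continuous_comp dC MC).
have [d /= d0 Hd] :=
  (nbhs_ballP _ _).1 (filterI (lt_nbhsr x0) (continuous_near_le Q_cont)).
pose b := x + d / 2.
have near_ab y : y \in `[x, b]%R -> 0 < y /\ `|Q y| <= `|Q x| + 1.
  rewrite in_itv/= => /andP[xy yb]; apply: Hd; rewrite /ball/= distrC ger0_norm ?subr_ge0//.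
  by rewrite /b in yb; lra.
have c10 := c1_gt0 gd.
have f'0 : forall y, y \in `[x, b]%R -> 'D_1 f y = 0.
  apply: (@gronwall_eq0 _ ('D_1 f) ('D_1 ('D_1 f)) x b ((`|Q x| + 1) / c1 g) _ _ f'x).
  - move=> y /near_ab[y0 _]; apply: derivableP; rewrite -f'E; exact: (f_smooth 1%N).
  - move=> y /near_ab[y0 Qy] f'y.
    have E := characteristic_identity f_mono f_smooth gd M_mean y0 f'y.
    rewrite -QE in E.
    rewrite mulrAC ler_pdivlMr// -[X in _ * X <= _](gtr0_norm c10) mulrC -normrM.
    by rewrite -E normrM mulrC ler_wpM2r.
have xb : x < b by rewrite /b; lra.
have [||z zxb fbx] := @MVT R f ('D_1 f) x b xb.
- move=> y /subset_itv_oo_cc/near_ab[y0 _]; apply: derivableP; exact: (f_smooth 0%N).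
- by apply: derivable_within_continuous => y /near_ab[y0 _]; exact: (f_smooth 0%N).
have /eqP : f b - f x = 0 by rewrite fbx f'0 ?mul0r//; exact: subset_itv_oo_cc.
by rewrite subr_eq0 => /eqP; case: f_mono => /(_ x b x0 xb) + fE; rewrite fE ltxx.
Qed.

Theorem proposition3p46 (R : realType) (f g : R -> R)
  (f_mono : strictly_monotonic_pos f) (f_smooth : smooth_pos f)
  (g_distr : symmetric_distribution g)
  (M_mean : mean (integral_mean f g)) :
  forall x : R, 0 < x ->
    f^`() x != 0 /\
    characteristic (integral_mean f g) x =
      c1 g * ((f^`(2))%classic x / (f^`())%classic x).
Proof.
move=> x x0.
have f'E : f^`() = 'D_1 f by apply/funext => y; rewrite derive1E.
have f'x := derive_neq0 f_mono f_smooth g_distr M_mean x0.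
have E := characteristic_identity f_mono f_smooth g_distr M_mean x0 f'x.
have f''E : (f^`(2))%classic x = 'D_1 ('D_1 f) x by rewrite -f'E -derive1E.
rewrite f''E f'E; split; first exact: f'x.
move: (characteristic _ x) (c1 g) ('D_1 f x) ('D_1 ('D_1 f) x) E f'x.
clear; move=> q c d1 d2 E d1_neq0.
by rewrite mulrA -E mulrAC mulfV// mul1r.
Qed.
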